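(* The function $$D(x)=\mathcal{K}(\sqrt{x})-\ln\left(1+\frac{4}{\sqrt{1-x}}\right)$$ is strictly convex on $(0,1)$.
   Context: For $r\in(0,1)$, $\mathcal{K}(r)=\int_{0}^{\pi/2}\frac{dt}{\sqrt{1-r^{2}\sin^{2}t}}$ is Legendre's complete elliptic integral of the first kind. *)

(* Defs.v *)
From Stdlib Require Import Reals.
From Coquelicot Require Import Coquelicot.
Open Scope R_scope.

(* Only meaningful for |r| < 1: otherwise the integrand is singular or takes
   the junk values of [sqrt] and [/]. *)
Definition ellipticK (r : R) : R :=
  RInt (fun t => 1 / sqrt (1 - r ^ 2 * sin t ^ 2)) 0 (PI / 2).

Definition strictly_convex_on (a b : R) (f : R -> R) : Prop :=
  forall x y t : R, a < x < b -> a < y < b -> x <> y -> 0 < t < 1 ->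
    f (t * x + (1 - t) * y) < t * f x + (1 - t) * f y.

(* Main.v *)
(* Write s = sqrt (1 - x) and Delta = sqrt (1 - x sin^2 t).  Differentiating under
   the integral, D'' > 0 amounts to
     s^4 K'' > (8 + 3 s) / (4 + s)^2,  where K'' = 3/4 int_0^{PI/2} sin^4 t / Delta^5 dt.
   For s <= 0.49, bounding sin^4 t below by sin t (1 - 3/2 cos^2 t) makes the integral
   elementary in v = cos t / Delta and gives s^4 K'' >= 1/2 - s^2/8.
   For s >= 0.49, Euler's transformation s^4 int sin^4 t / Delta^5 = int cos^4 t / Delta
   and the quadratic Taylor bound for 1 / Delta give
     s^4 K'' >= 9 PI / 64 (1 + x/12 + 3 x^2/128).
   The second bound is needed with PI > 3.14, since at x = 0 the two sides are
   9 PI / 64 = 0.4418 and 11 / 25. *)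
Require Import Defs.
From Stdlib Require Import Reals Lra Lia.
From Coquelicot Require Import Coquelicot.
Open Scope R_scope.

(** * Strict convexity from a positive second derivative *)

Lemma strictly_convex_on_derive2 (a b : R) (f f1 f2 : R -> R) :
  (forall x, a < x < b -> is_derive f x (f1 x)) ->
  (forall x, a < x < b -> is_derive f1 x (f2 x)) ->
  (forall x, a < x < b -> 0 < f2 x) ->
  strictly_convex_on a b f.
Proof.
intros Hf Hf1 Hpos.
assert (mvt : forall g g1, (forall x, a < x < b -> is_derive g x (g1 x)) ->
    forall x y, a < x -> x < y -> y < b ->
    exists c, g y - g x = g1 c * (y - x) /\ x < c < y).
{ intros g g1 Hg x y Hx Hxy Hy. apply MVT_cor2; [exact Hxy|].
  intros c Hc. apply is_derive_Reals, Hg. lra. }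
assert (incr : forall x y, a < x -> x < y -> y < b -> f1 x < f1 y).
{ intros x y Hx Hxy Hy. destruct (mvt f1 f2 Hf1 x y Hx Hxy Hy) as [c [Hc Hcxy]].
  assert (0 < f2 c) by (apply Hpos; lra). nra. }
assert (conv : forall x y t, a < x -> x < y -> y < b -> 0 < t < 1 ->
    f (t * x + (1 - t) * y) < t * f x + (1 - t) * f y).
{ intros x y t Hx Hxy Hy Ht. set (z := t * x + (1 - t) * y).
  assert (Hzx : z - x = (1 - t) * (y - x)) by (unfold z; ring).
  assert (Hyz : y - z = t * (y - x)) by (unfold z; ring).
  assert (x < z < y) by (split; nra).
  (* The mean value theorem on each side of [z] gives [c < z < d]; the convexity gap becomes a
     positive multiple of [f1 d - f1 c]. *)
  destruct (mvt f f1 Hf x z) as [c [Hc Hcxz]]; try lra.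
  destruct (mvt f f1 Hf z y) as [d [Hd Hdzy]]; try lra.
  assert (Hcd : f1 c < f1 d) by (apply incr; lra).
  rewrite Hzx in Hc. rewrite Hyz in Hd.
  assert (0 < t * (1 - t) * (y - x)) by (apply Rmult_lt_0_compat; nra).
  assert (t * f x + (1 - t) * f y - f z
          = t * (1 - t) * (y - x) * (f1 d - f1 c)) by nra.
  nra. }
intros x y t Hx Hy Hxy Ht.
destruct (Rtotal_order x y) as [H|[H|H]]; [|contradiction|].
- apply conv; lra.
- replace (t * x + (1 - t) * y) with ((1 - t) * y + (1 - (1 - t)) * x) by ring.
  replace (t * f x + (1 - t) * f y)
    with ((1 - t) * f y + (1 - (1 - t)) * f x) by ring.
  apply conv; lra.
Qed.

(** * Differentiation of the elliptic integral under the integral sign *)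

Lemma sin2_le1 (t : R) : sin t ^ 2 <= 1.
Proof. generalize (SIN_bound t). nra. Qed.

Lemma radicand_gt0 (x t : R) : x < 1 -> 0 < 1 - x * sin t ^ 2.
Proof.
intros Hx. generalize (sin2_le1 t) (pow2_ge_0 (sin t)).
destruct (Rle_lt_dec 0 x); nra.
Qed.

Definition ell_delta (x t : R) : R := sqrt (1 - x * sin t ^ 2).

Lemma ell_delta_gt0 (x t : R) : x < 1 -> 0 < ell_delta x t.
Proof. intros Hx. apply sqrt_lt_R0, radicand_gt0, Hx. Qed.

Lemma ell_delta_sqr (x t : R) : x < 1 -> ell_delta x t ^ 2 = 1 - x * sin t ^ 2.
Proof. intros Hx. apply pow2_sqrt, Rlt_le, radicand_gt0, Hx. Qed.

(** Each x-derivative contributes a factor sin^2 t / Delta^2, so this family is closed under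
    differentiation up to constants. *)
Definition dK_integrand (k : nat) (x t : R) : R :=
  sin t ^ (2 * k) / ell_delta x t ^ (2 * k + 1).

(* Up to a constant factor, the k-th derivative of x |-> K (sqrt x). *)
Definition dK (k : nat) (x : R) : R := RInt (dK_integrand k x) 0 (PI / 2).

Lemma is_derive_ell_delta_l (x t : R) :
  x < 1 -> is_derive (fun u => ell_delta u t) x (- sin t ^ 2 / (2 * ell_delta x t)).
Proof.
intros Hx. unfold ell_delta. generalize (radicand_gt0 x t Hx). intros H.
auto_derive; [exact H|].
generalize (sqrt_lt_R0 _ H). intros H'.
change (1 + - (x * (sin t * (sin t * 1)))) with (1 - x * sin t ^ 2).
field. lra.
Qed.

Lemma is_derive_ell_delta_r (x t : R) :
  x < 1 -> is_derive (ell_delta x) t (- x * sin t * cos t / ell_delta x t).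
Proof.
intros Hx. unfold ell_delta. generalize (radicand_gt0 x t Hx). intros H.
auto_derive; [exact H|].
generalize (sqrt_lt_R0 _ H). intros H'.
change (1 + - (x * (sin t * (sin t * 1)))) with (1 - x * sin t ^ 2).
field. lra.
Qed.

Lemma is_derive_dK_integrand (k : nat) (x t : R) :
  x < 1 -> is_derive (fun u => dK_integrand k u t) x
             ((2 * INR k + 1) / 2 * dK_integrand (S k) x t).
Proof.
intros Hx. generalize (ell_delta_gt0 x t Hx) (is_derive_ell_delta_l x t Hx).
(* Delta is made opaque so that [auto_derive] relies on the derivative [HD] and does not open the
   square root. *)
unfold dK_integrand. set (D := fun u : R => ell_delta u t).
change (fun u : R_AbsRing => ell_delta u t) with D.
change (ell_delta x t) with (D x). intros H HD.
change (is_derive (fun u => sin t ^ (2 * k) / D u ^ (2 * k + 1)) x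
  ((2 * INR k + 1) / 2 * (sin t ^ (2 * S k) / D x ^ (2 * S k + 1)))).
clearbody D. assert (D x <> 0) by lra.
assert (D x ^ (2 * k) <> 0) by (apply pow_nonzero; lra).
auto_derive.
- split; [eexists; exact HD|]. split; [|exact I]. apply pow_nonzero; lra.
- rewrite (is_derive_unique (fun z : R => D z) _ _ HD).
  replace (pred (k + (k + 0) + 1)) with (2 * k)%nat by lia.
  replace (k + (k + 0))%nat with (2 * k)%nat by lia.
  replace (2 * S k)%nat with (2 * k + 2)%nat by lia.
  replace (INR (2 * k + 1)) with (2 * INR k + 1)
    by (rewrite plus_INR, mult_INR; simpl; ring).
  rewrite !pow_add. simpl pow. field. auto.
Qed.

Lemma continuity_2d_pt_pow (f : R -> R -> R) (n : nat) (x y : R) :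
  continuity_2d_pt f x y -> continuity_2d_pt (fun u v => f u v ^ n) x y.
Proof.
intros Hf. induction n as [|n IH]; simpl.
- apply continuity_2d_pt_const.
- apply continuity_2d_pt_mult; assumption.
Qed.

(** Differentiation under the integral requires the x-derivative to be continuous in both variables
    jointly. *)
Lemma continuity_2d_pt_dK_integrand (k : nat) (x t : R) :
  x < 1 -> continuity_2d_pt (dK_integrand k) x t.
Proof.
intros Hx.
assert (Hsin : continuity_2d_pt (fun _ v => sin v) x t).
{ apply (continuity_1d_2d_pt_comp sin (fun _ v => v)).
  - apply continuity_sin.
  - apply continuity_2d_pt_id2. }
unfold dK_integrand, Rdiv. apply continuity_2d_pt_mult.
- apply continuity_2d_pt_pow, Hsin.
- apply continuity_2d_pt_inv.
  + apply continuity_2d_pt_pow. unfold ell_delta.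
    apply (continuity_1d_2d_pt_comp sqrt (fun u v => 1 - u * sin v ^ 2)).
    * apply continuity_pt_sqrt, Rlt_le, radicand_gt0, Hx.
    * apply continuity_2d_pt_minus; [apply continuity_2d_pt_const|].
      apply continuity_2d_pt_mult; [apply continuity_2d_pt_id1|].
      apply continuity_2d_pt_pow, Hsin.
  + apply pow_nonzero, Rgt_not_eq, ell_delta_gt0, Hx.
Qed.

Lemma continuous_dK_integrand (k : nat) (x t : R) :
  x < 1 -> continuous (dK_integrand k x) t.
Proof.
intros Hx. apply (ex_derive_continuous (dK_integrand k x)).
unfold dK_integrand. auto_derive. split; [|split; [|exact I]].
- eexists. apply is_derive_ell_delta_r, Hx.
- apply pow_nonzero, Rgt_not_eq, ell_delta_gt0, Hx.
Qed.

Lemma ex_RInt_dK_integrand (k : nat) (x : R) :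
  x < 1 -> ex_RInt (dK_integrand k x) 0 (PI / 2).
Proof.
intros Hx. apply (ex_RInt_continuous (dK_integrand k x)).
intros t _. apply continuous_dK_integrand, Hx.
Qed.

Lemma locally_lt1 (x : R) : x < 1 -> locally x (fun u => u < 1).
Proof. intros Hx. apply (open_lt 1 x Hx). Qed.

Lemma is_derive_dK (k : nat) (x : R) :
  x < 1 -> is_derive (dK k) x ((2 * INR k + 1) / 2 * dK (S k) x).
Proof.
intros Hx.
assert (Hd : forall u t, u < 1 -> Derive (fun z => dK_integrand k z t) u
                         = (2 * INR k + 1) / 2 * dK_integrand (S k) u t).
{ intros u t Hu. apply is_derive_unique, is_derive_dK_integrand, Hu. }
replace ((2 * INR k + 1) / 2 * dK (S k) x)
  with (RInt (fun t => Derive (fun u => dK_integrand k u t) x) 0 (PI / 2)).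
- apply is_derive_RInt_param.
  + apply filter_imp with (2 := locally_lt1 x Hx). intros u Hu t _.
    eexists. apply is_derive_dK_integrand, Hu.
  + intros t _.
    (* The closed form of the derivative is available only for [u < 1], hence the passage through a
       neighbourhood of [x]. *)
    apply continuity_2d_pt_ext_loc
      with (fun u v => (2 * INR k + 1) / 2 * dK_integrand (S k) u v).
    * destruct (locally_lt1 x Hx) as [d Hdl]. exists d. intros u v Hu _.
      symmetry. apply Hd, Hdl. exact Hu.
    * apply continuity_2d_pt_mult; [apply continuity_2d_pt_const|].
      apply continuity_2d_pt_dK_integrand, Hx.
  + apply filter_imp with (2 := locally_lt1 x Hx). intros u Hu.
    apply ex_RInt_dK_integrand, Hu.
- unfold dK. rewrite <- (RInt_scal (V := R_CompleteNormedModule)).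
  + apply RInt_ext. intros t _. apply Hd, Hx.
  + apply ex_RInt_dK_integrand, Hx.
Qed.

Lemma ellipticK_sqrt (x : R) : 0 <= x -> ellipticK (sqrt x) = dK 0 x.
Proof.
intros Hx. apply RInt_ext. intros t _. unfold dK_integrand, ell_delta.
rewrite pow2_sqrt by exact Hx. simpl. rewrite !Rmult_1_r. reflexivity.
Qed.

(** * Lower bounds for the integral of sin^4 t / Delta^5 *)

Lemma cos2_sin2 (t : R) : cos t ^ 2 = 1 - sin t ^ 2.
Proof. generalize (sin2_cos2 t). unfold Rsqr. lra. Qed.

(** Otherwise 1/2 = sin (PI/6) <= sin a with a = 3.14/6, whereas sin a <= a - a^3/6 + a^5/120 <
    0.4998. *)
Lemma PI_gt_314 : 3.14 < PI.
Proof.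
apply Rnot_le_lt. intros H. generalize PI2_1. intros Hpi.
assert (Hs : sin (PI / 6) <= sin (3.14 / 6)) by (apply sin_incr_1; lra).
rewrite sin_PI6 in Hs.
generalize (proj2 (pre_sin_bound (3.14 / 6) 0 ltac:(lra) ltac:(lra))).
unfold sin_approx, sum_f_R0, sin_term. simpl. lra.
Qed.

(* The two integrands of Euler's transformation differ by the derivative of this
   function, which vanishes at 0 and PI/2.  It is the combination of
   sin t cos t Delta^j, j in {-3, -1, 1}, found by matching powers of sin^2 t. *)
Definition euler_primitive (x t : R) : R :=
  sin t * cos t
  * ((2 - 4 * x) * ell_delta x t ^ 2 - (1 - x) - ell_delta x t ^ 4)
  / (3 * x * ell_delta x t ^ 3).

Lemma is_derive_euler_primitive (x t : R) :
  0 < x < 1 ->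
  is_derive (euler_primitive x) t
    ((1 - x) ^ 2 * dK_integrand 2 x t - cos t ^ 4 / ell_delta x t).
Proof.
intros Hx. unfold euler_primitive, dK_integrand.
generalize (ell_delta_gt0 x t (proj2 Hx)) (ell_delta_sqr x t (proj2 Hx))
  (is_derive_ell_delta_r x t (proj2 Hx)) (cos2_sin2 t).
generalize (ell_delta x). intros D H Hsq HD Hc.
auto_derive.
- repeat split; try (eexists; exact HD).
  repeat apply Rmult_integral_contrapositive_currified; lra.
- rewrite (is_derive_unique (fun z : R => D z) _ _ HD).
  simpl Nat.mul. simpl Nat.add.
  revert Hsq Hc H. clear HD. generalize (sin t) (cos t) (D t). intros s c d.
  (* With denominators cleared, a polynomial identity modulo Delta^2 = 1 - x sin^2 t and cos^2 t = 1
     - sin^2 t remains. *)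
  intros Hsq Hc H. field_simplify_eq; [|lra].
  ring [Hsq Hc].
Qed.

(** Turns a lower bound for an integral into a pointwise comparison with an integrand whose
    primitive is explicit. *)
Lemma primitive_le_RInt (F F' f : R -> R) (a b : R) :
  a <= b -> (forall t, is_derive F t (F' t)) -> (forall t, continuous F' t) ->
  ex_RInt f a b -> (forall t, a < t < b -> F' t <= f t) ->
  F b - F a <= RInt f a b.
Proof.
intros Hab HF HF' Hf Hle.
assert (HI : is_RInt F' a b (F b - F a)).
{ apply (is_RInt_derive F F'); intros t _; [apply HF | apply HF']. }
rewrite <- (is_RInt_unique _ _ _ _ HI). apply RInt_le; auto.
eexists; exact HI.
Qed.

(** sin^3 t is convex as a function of sin^2 t, and the bracket is its tangent at sin^2 t = 1. *)
Lemma sin4_ge (t : R) : 0 <= sin t -> sin t * (1 - 3 / 2 * cos t ^ 2) <= sin t ^ 4.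
Proof.
intros H. rewrite cos2_sin2.
assert (0 <= sin t * ((1 - sin t) ^ 2 * (2 * sin t + 1))).
{ apply Rmult_le_pos; [exact H|]. apply Rmult_le_pos; [apply pow2_ge_0 | lra]. }
lra.
Qed.

(** Quadratic Taylor bound for (1 - u)^(-1/2) at u = 1 - d^2. The remainder, multiplied by 8 d,
    factors as (1 - d)^3 (8 + 9 d + 3 d^2). *)
Lemma inv_sqrt_ge (d : R) :
  0 < d <= 1 -> 1 + (1 - d ^ 2) / 2 + 3 / 8 * (1 - d ^ 2) ^ 2 <= / d.
Proof.
intros Hd. apply Rmult_le_reg_r with d; [lra|]. rewrite Rinv_l by lra.
assert (0 <= (1 - d) ^ 3 * (8 + 9 * d + 3 * d ^ 2)).
{ apply Rmult_le_pos; [apply pow_le; lra | nra]. }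
lra.
Qed.

Lemma ell_delta_0 (x : R) : ell_delta x 0 = 1.
Proof.
unfold ell_delta. rewrite sin_0, pow_i, Rmult_0_r, Rminus_0_r by lia. apply sqrt_1.
Qed.

Lemma sin_ge0_quarter (t : R) : 0 < t < PI / 2 -> 0 <= sin t.
Proof. intros Ht. generalize PI_RGT_0. intros. apply sin_ge_0; lra. Qed.

Lemma dK2_ge_near1 (x : R) :
  x < 1 -> 1 / 2 - (1 - x) / 8 <= 3 / 4 * ((1 - x) ^ 2 * dK 2 x).
Proof.
intros Hx.
(* With v = cos t / Delta, dv/dt = -(1 - x) sin t / Delta^3 and 1 - x v^2 = (1 - x) / Delta^2, so
   the minorant integrates to a cubic in v. As v goes from 1 to 0, the integral is 1/2 + x/6. *)
set (F := fun t => (1 - x) / 2 * (cos t / ell_delta x t) ^ 3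
  - (cos t / ell_delta x t - x / 3 * (cos t / ell_delta x t) ^ 3)).
assert (H : F (PI / 2) - F 0
            <= RInt (fun t => (1 - x) ^ 2 * dK_integrand 2 x t) 0 (PI / 2)).
{ apply (primitive_le_RInt F (fun t => (1 - x) ^ 2 *
    (sin t * (1 - 3 / 2 * cos t ^ 2) / ell_delta x t ^ 5))).
  - generalize PI_RGT_0. lra.
  - intros t. unfold F.
    generalize (ell_delta_gt0 x t Hx) (ell_delta_sqr x t Hx)
      (is_derive_ell_delta_r x t Hx) (cos2_sin2 t).
    generalize (ell_delta x). intros D H Hsq HD Hc. auto_derive.
    + repeat split; try (eexists; exact HD); lra.
    + rewrite (is_derive_unique (fun z : R => D z) _ _ HD).
      revert Hsq Hc H. clear HD. generalize (sin t) (cos t) (D t).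
      intros s c d Hsq Hc H.
      assert (Hs : s ^ 2 = 1 - c ^ 2) by lra.
      field_simplify_eq; [|lra]. rewrite Hs in Hsq.
      ring [Hsq Hs].
  - intros t. apply (ex_derive_continuous (V := R_NormedModule)). auto_derive.
    repeat split.
    + eexists. apply is_derive_ell_delta_r, Hx.
    + apply (pow_nonzero _ 5), Rgt_not_eq, ell_delta_gt0, Hx.
  - apply (ex_RInt_scal (V := R_NormedModule)), ex_RInt_dK_integrand, Hx.
  - intros t Ht. unfold dK_integrand. apply Rmult_le_compat_l; [apply pow2_ge_0|].
    apply Rmult_le_compat_r.
    + apply Rlt_le, Rinv_0_lt_compat, pow_lt, ell_delta_gt0, Hx.
    + apply sin4_ge, sin_ge0_quarter, Ht. }
rewrite (RInt_scal (V := R_CompleteNormedModule) (dK_integrand 2 x)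
  _ _ ((1 - x) ^ 2)) in H
  by apply ex_RInt_dK_integrand, Hx.
change (scal ((1 - x) ^ 2) (RInt (dK_integrand 2 x) 0 (PI / 2)))
  with ((1 - x) ^ 2 * dK 2 x) in H.
unfold F in H. rewrite ell_delta_0, cos_PI2, cos_0 in H.
unfold Rdiv in H. rewrite Rmult_0_l, Rinv_1 in H. lra.
Qed.

(** The integrals of cos^4, cos^4 sin^2 and cos^4 sin^4 over [0, PI/2] are 3 PI / 16, PI / 32 and 3
    PI / 256; the Taylor weights 1, x/2 and 3 x^2 / 8 combine them into the quadratic. *)
Lemma dK2_ge_near0 (x : R) :
  0 < x < 1 ->
  9 * PI / 64 * (1 + x / 12 + 3 / 128 * x ^ 2) <= 3 / 4 * ((1 - x) ^ 2 * dK 2 x).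
Proof.
intros Hx.
set (W0 := fun t => sin t * cos t ^ 3 / 4 + 3 / 8 * (sin t * cos t + t)).
set (W1 := fun t => W0 t / 6 - sin t * cos t ^ 5 / 6).
set (W2 := fun t => 3 / 8 * W1 t - sin t ^ 3 * cos t ^ 5 / 8).
(* [W0], [W1], [W2] are primitives of [cos^4], [cos^4 sin^2], [cos^4 sin^4]. *)
set (F := fun t => euler_primitive x t
   + (W0 t + x / 2 * W1 t + 3 / 8 * x ^ 2 * W2 t)).
set (F' := fun t => (1 - x) ^ 2 * dK_integrand 2 x t - cos t ^ 4 / ell_delta x t
   + cos t ^ 4 * (1 + x / 2 * sin t ^ 2 + 3 / 8 * x ^ 2 * sin t ^ 4)).
assert (H : F (PI / 2) - F 0
            <= RInt (fun t => (1 - x) ^ 2 * dK_integrand 2 x t) 0 (PI / 2)).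
{ apply (primitive_le_RInt F F').
  - generalize PI_RGT_0. lra.
  - intros t. apply (is_derive_plus (V := R_NormedModule)).
    + apply is_derive_euler_primitive, Hx.
    + unfold W2, W1, W0. auto_derive; [exact I|].
      generalize (cos2_sin2 t). generalize (sin t) (cos t). intros s c Hc.
      assert (Hs : s ^ 2 = 1 - c ^ 2) by lra.
      field_simplify_eq. ring [Hs].
  - intros t. unfold F', dK_integrand.
    apply (ex_derive_continuous (V := R_NormedModule)). auto_derive.
    repeat split; try (eexists; apply is_derive_ell_delta_r, Hx).
    + apply (pow_nonzero _ 5), Rgt_not_eq, ell_delta_gt0, Hx.
    + apply Rgt_not_eq, ell_delta_gt0, Hx.
  - apply (ex_RInt_scal (V := R_NormedModule)), ex_RInt_dK_integrand, Hx.
  - intros t Ht. unfold F'.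
    generalize (ell_delta_gt0 x t (proj2 Hx)) (ell_delta_sqr x t (proj2 Hx)).
    intros H Hsq.
    assert (ell_delta x t <= 1) by (generalize (pow2_ge_0 (sin t)); nra).
    (* Here 1 - d^2 is x sin^2 t; the bound is then multiplied by cos^4 t >= 0. *)
    generalize (inv_sqrt_ge (ell_delta x t) ltac:(lra)). rewrite Hsq. intros Hi.
    assert (0 <= cos t ^ 4) by (replace (cos t ^ 4) with ((cos t ^ 2) ^ 2) by ring;
      apply pow2_ge_0).
    unfold Rdiv at 1. nra. }
rewrite (RInt_scal (V := R_CompleteNormedModule) (dK_integrand 2 x)
  _ _ ((1 - x) ^ 2)) in H
  by apply ex_RInt_dK_integrand, Hx.
change (scal ((1 - x) ^ 2) (RInt (dK_integrand 2 x) 0 (PI / 2)))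
  with ((1 - x) ^ 2 * dK 2 x) in H.
unfold F, W2, W1, W0, euler_primitive in H.
rewrite ell_delta_0, cos_PI2, cos_0, sin_PI2, sin_0 in H.
unfold Rdiv in H. rewrite !Rmult_0_l, !Rmult_0_r, !Rmult_0_l in H. lra.
Qed.

(** * The two polynomial inequalities in s *)

Lemma numeric_near1 (s : R) :
  0 < s <= 49 / 100 -> 8 + 3 * s < (1 / 2 - s ^ 2 / 8) * (4 + s) ^ 2.
Proof.
intros [Hs0 Hs1].
(* This is 8 times the difference of the two sides. The cubic decreases and vanishes between 0.49
   and 0.5, whence the threshold. *)
assert (0 < s * (8 - 12 * s - 8 * s ^ 2 - s ^ 3)).
{ assert (s ^ 2 <= 49 / 100 * s) by nra. assert (s ^ 3 <= 49 / 100 * s ^ 2) by nra.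
  apply Rmult_lt_0_compat; lra. }
lra.
Qed.

Lemma numeric_near0 (s x : R) :
  49 / 100 <= s <= 1 -> x = 1 - s ^ 2 ->
  8 + 3 * s < 9 * 3.14 / 64 * (1 + x / 12 + 3 / 128 * x ^ 2) * (4 + s) ^ 2.
Proof.
intros Hs ->. replace s with (1 - (1 - s)) by ring.
assert (He : 0 <= 1 - s <= 51 / 100) by lra. clear Hs.
revert He. generalize (1 - s). intros e He.
(* The decimals are the coefficients of e to e^5 in the difference of the two sides, rounded down;
   its constant term is about 0.039 and its e^6 coefficient is positive. *)
assert (0 <= e * (0.42 - 0.18 * e - 1.01 * e ^ 2)) by (apply Rmult_le_pos; nra).
assert (0 <= e ^ 4 * (0.67 - 0.15 * e)) by (apply Rmult_le_pos; [apply pow_le|]; lra).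
assert (0 <= e ^ 2) by apply pow2_ge_0.
assert (0 <= e ^ 3) by (apply pow_le; lra).
assert (0 <= e ^ 4) by (apply pow_le; lra).
assert (0 <= e ^ 5) by (apply pow_le; lra).
assert (0 <= e ^ 6) by (apply pow_le; lra).
lra.
Qed.

Lemma dK2_gt (x s : R) :
  0 < x < 1 -> 0 < s -> s ^ 2 = 1 - x ->
  (8 + 3 * s) / (s ^ 4 * (4 + s) ^ 2) < 3 / 4 * dK 2 x.
Proof.
intros Hx Hs Hsx.
assert (H4 : 0 < s ^ 4) by (apply pow_lt; lra).
assert (Hq : 0 < (4 + s) ^ 2) by (apply pow_lt; lra).
assert (H : 8 + 3 * s < 3 / 4 * ((1 - x) ^ 2 * dK 2 x) * (4 + s) ^ 2).
{ destruct (Rle_lt_dec s (49 / 100)) as [Hs'|Hs'].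
  - apply Rlt_le_trans with (1 := numeric_near1 s (conj Hs Hs')).
    apply Rmult_le_compat_r; [lra|]. rewrite Hsx. apply dK2_ge_near1, Hx.
  - apply Rlt_le_trans with (1 := numeric_near0 s x ltac:(split; nra) ltac:(lra)).
    apply Rmult_le_compat_r; [lra|].
    apply Rle_trans with (2 := dK2_ge_near0 x Hx).
    apply Rmult_le_compat_r; [nra|]. generalize PI_gt_314. lra. }
apply Rmult_lt_reg_r with (s ^ 4 * (4 + s) ^ 2); [apply Rmult_lt_0_compat; assumption|].
unfold Rdiv at 1. rewrite Rmult_assoc, Rinv_l by nra.
rewrite <- Hsx in H. nra.
Qed.

(** * Derivatives of the logarithmic term and conclusion *)

Definition log_part (x : R) : R := ln (1 + 4 / sqrt (1 - x)).
Definition log_part' (x : R) : R := 2 / ((1 - x) * (4 + sqrt (1 - x))).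

Lemma is_derive_log_part (x : R) : x < 1 -> is_derive log_part x (log_part' x).
Proof.
intros Hx. unfold log_part, log_part'. assert (H : 0 < 1 - x) by lra.
generalize (sqrt_lt_R0 _ H) (pow2_sqrt (1 - x) (Rlt_le _ _ H)). intros Hs Hs2.
auto_derive; change (1 + - x) with (1 - x).
- repeat split; try lra. assert (0 < 4 / sqrt (1 - x)) by (apply Rdiv_lt_0_compat; lra).
  unfold Rdiv in *; lra.
- revert Hs Hs2. generalize (sqrt (1 - x)). intros s Hs Hs2.
  rewrite <- Hs2. field. repeat split; lra.
Qed.

Lemma is_derive_log_part' (x : R) :
  x < 1 -> is_derive log_part' x
    ((8 + 3 * sqrt (1 - x)) / (sqrt (1 - x) ^ 4 * (4 + sqrt (1 - x)) ^ 2)).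
Proof.
intros Hx. unfold log_part'. assert (H : 0 < 1 - x) by lra.
generalize (sqrt_lt_R0 _ H) (pow2_sqrt (1 - x) (Rlt_le _ _ H)). intros Hs Hs2.
auto_derive; change (1 + - x) with (1 - x).
- repeat split; nra.
- revert Hs Hs2. generalize (sqrt (1 - x)). intros s Hs Hs2.
  rewrite <- Hs2. field. nra.
Qed.

Theorem theorem3 :
  strictly_convex_on 0 1
    (fun x : R => ellipticK (sqrt x) - ln (1 + 4 / sqrt (1 - x))).
Proof.
assert (H : strictly_convex_on 0 1 (fun x => dK 0 x - log_part x)).
{ apply strictly_convex_on_derive2 with
    (fun x => 1 / 2 * dK 1 x - log_part' x)
    (fun x => 3 / 4 * dK 2 x
       - (8 + 3 * sqrt (1 - x)) / (sqrt (1 - x) ^ 4 * (4 + sqrt (1 - x)) ^ 2)).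
  - intros x Hx. apply (is_derive_minus (V := R_NormedModule)).
    + generalize (is_derive_dK 0 x (proj2 Hx)). simpl INR.
      replace ((2 * 0 + 1) / 2) with (1 / 2) by field. auto.
    + apply is_derive_log_part, Hx.
  - intros x Hx. apply (is_derive_minus (V := R_NormedModule)).
    + replace (3 / 4 * dK 2 x) with (1 / 2 * ((2 * INR 1 + 1) / 2 * dK 2 x))
        by (simpl; field).
      apply is_derive_scal, is_derive_dK, Hx.
    + apply is_derive_log_part', Hx.
  - intros x Hx. apply Rlt_0_minus, dK2_gt; [exact Hx | |].
    + apply sqrt_lt_R0. lra.
    + apply pow2_sqrt. lra. }
intros x y t Hx Hy Hxy Ht. rewrite !ellipticK_sqrt by nra.
exact (H x y t Hx Hy Hxy Ht).
Qed.
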